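(* Let $u:\overline{\Omega}\to\mathbb{R}$ be a bounded convex function and, for each (small) $h>0$, let $u_h$ be a mesh function on $\mathcal{N}_h$. If $u_h$ converges to $u$ uniformly on $\overline{\Omega}$, then $\Gamma(u_h)$ converges to $u$ uniformly on compact subsets of $\Omega$.
   Context: $\Omega\subset\mathbb{R}^d$ is a nonempty bounded convex domain (open) with boundary $\partial\Omega$. For $h>0$: $\mathbb{Z}^d_h=\{mh: m\in\mathbb{Z}^d\}$ and $\Omega_h=\Omega\cap\mathbb{Z}^d_h$; $h$ is always small enough that $\Omega_h\neq\emptyset$. $(r_1,\dots,r_d)$ is the canonical basis of $\mathbb{R}^d$. For $x\in\Omega_h$ and $e\in\mathbb{Z}^d$, $h^e_x=\sup\{rh: r\in[0,1],\ x+rhe\in\overline{\Omega}\}$. $V\subset\mathbb{Z}^d\setminus\{0\}$ is a fixed set of directions containing $r_1,\dots,r_d$, with $-e\in V$ whenever $e\in V$, and such that each $e\in V$ is the first element of some basis of $\mathbb{Z}^d$ (the choice $V=\mathbb{Z}^d\setminus\{0\}$ is also allowed). $\partial\Omega_h=\{x\in\partial\Omega: x=y+h^e_y e \text{ for some } y\in\Omega_h, e\in V\}$, $\mathcal{N}_h=\Omega_h\cup\partial\Omega_h$. A mesh function is a function $u_h:\mathcal{N}_h\to\mathbb{R}$. $u_h$ converges to $u$ uniformly on $\overline{\Omega}$ if for each sequence $h_k\to0$ and each $\epsilon>0$ there is $h_{-1}>0$ such that for all $h_k$ with $0<h_k<h_{-1}$ one has $|u_{h_k}(x)-u(x)|<\epsilon$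 for all $x\in\mathcal{N}_{h_k}$. The convex envelope of $u_h$ is $\Gamma(u_h)(x)=\sup\{L(x): L \text{ affine}, L(y)\le u_h(y)\ \forall y\in\mathcal{N}_h\}$. It is considered on the convex hull $\operatorname{Conv}(\mathcal{N}_h)$, which contains any given compact subset of $\Omega$ for $h$ small enough; uniform convergence on compact subsets of $\Omega$ means that for every compact $K\subset\Omega$ and every sequence $h_k\to0$, $\sup_{K}|\Gamma(u_{h_k})-u|\to0$. *)

(* Defs.v *)
(* MathComp-Analysis: R^d is 'rV[R]_d for R : realType, and Z^d is 'rV[int]_d. *)
From HB Require Import structures.
From mathcomp Require Import all_boot all_order all_algebra.
From mathcomp Require Import all_classical all_reals all_analysis.

Set Implicit Arguments.
Unset Strict Implicit.
Unset Printing Implicit Defensive.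

Import Order.TTheory GRing.Theory Num.Theory.
Import numFieldNormedType.Exports.

Local Open Scope classical_set_scope.
Local Open Scope ring_scope.

Definition vecZ (R : realType) (d : nat) (m : 'rV[int]_d) : 'rV[R]_d :=
  map_mx intr m.
Arguments vecZ R {d} m.

Definition is_Zbasis (d : nat) (b : 'I_d -> 'rV[int]_d) : Prop :=
  forall z : 'rV[int]_d,
    exists! c : 'rV[int]_d, z = \sum_(i < d) c ord0 i *: b i.

Definition first_of_Zbasis (d : nat) (e : 'rV[int]_d) : Prop :=
  exists2 b : 'I_d -> 'rV[int]_d,
    is_Zbasis b & exists2 i : 'I_d, val i = 0%N & b i = e.

Definition direction_set (d : nat) (V : set 'rV[int]_d) : Prop :=
  [/\ V `<=` [set~ 0],
      forall i : 'I_d, V (delta_mx ord0 i),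
      forall e, V e -> V (- e)
    & (forall e, V e -> first_of_Zbasis e) \/ V = [set~ 0]].

Definition bounded_convex_domain (R : realType) (d : nat)
    (Omega : set 'rV[R]_d) : Prop :=
  [/\ open Omega, Omega !=set0, bounded_set Omega & convex_set Omega].

Definition boundary (R : realType) (d : nat) (A : set 'rV[R]_d) :
    set 'rV[R]_d :=
  closure A `\` interior A.

Definition grid (R : realType) (d : nat) (h : R) : set 'rV[R]_d :=
  range (fun m : 'rV[int]_d => h *: vecZ R m).

Section Mesh.
Variables (R : realType) (d : nat).
Variables (Omega : set 'rV[R]_d) (V : set 'rV[int]_d) (h : R).

Definition interior_mesh : set 'rV[R]_d := Omega `&` grid h.

Definition mesh_step (x : 'rV[R]_d) (e : 'rV[int]_d) : R :=
  sup [set r * h | r in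
         [set r : R | 0 <= r <= 1 /\ closure Omega (x + (r * h) *: vecZ R e)]].

Definition boundary_mesh : set 'rV[R]_d :=
  [set x | boundary Omega x /\
     exists y e, [/\ interior_mesh y, V e & x = y + mesh_step y e *: vecZ R e]].

Definition mesh : set 'rV[R]_d := interior_mesh `|` boundary_mesh.

End Mesh.

Definition affine_fun (R : realType) (d : nat) (L : 'rV[R]_d -> R) : Prop :=
  exists (a : 'rV[R]_d) (b : R),
    forall x, L x = \sum_(i < d) a ord0 i * x ord0 i + b.

(* The supremum is taken in the extended reals: for finite N it is +oo at the
   points outside the convex hull of N. *)
Definition convex_envelope (R : realType) (d : nat) (N : set 'rV[R]_d)
    (v : 'rV[R]_d -> R) (x : 'rV[R]_d) : \bar R :=
  ereal_sup [set (L x)%:E | L in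
    [set L : 'rV[R]_d -> R | affine_fun L /\ forall y, N y -> L y <= v y]].

(* A function on a subset D of R^d (a mesh function, or u on the closure of
   Omega) is a total function of which only the values on D are used. *)
Section Convergence.
Variables (R : realType) (d : nat).
Variables (Omega : set 'rV[R]_d) (V : set 'rV[int]_d).
Variables (u_ : R -> 'rV[R]_d -> R) (u : 'rV[R]_d -> R).

Definition mesh_size_seq (h : nat -> R) : Prop :=
  (forall k, 0 < h k) /\ h k @[k --> \oo] --> (0 : R).

Definition mesh_cvg_uniform : Prop :=
  forall (h : nat -> R), mesh_size_seq h ->
  forall eps : R, 0 < eps ->
  exists2 h1 : R, 0 < h1 &
    forall k, 0 < h k < h1 ->
    forall x, mesh Omega V (h k) x -> `|u_ (h k) x - u x| < eps.

(* Supremum in [0, +oo] of a nonnegative g; it is 0 if K is empty. *)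
Definition sup_on (K : set 'rV[R]_d) (g : 'rV[R]_d -> \bar R) : \bar R :=
  maxe 0%E (ereal_sup (g @` K)).

Definition envelope_cvg_compact : Prop :=
  forall K : set 'rV[R]_d, compact K -> K `<=` Omega ->
  forall h : nat -> R, mesh_size_seq h ->
    sup_on K (fun x => `| convex_envelope (mesh Omega V (h k)) (u_ (h k)) x
                          - (u x)%:E |)%E @[k --> \oo] --> (0%E : \bar R).

End Convergence.

(* Main.v *)
Require Import Defs.
From HB Require Import structures.
From mathcomp Require Import all_boot all_order all_algebra.
From mathcomp Require Import all_classical all_reals all_analysis.
From mathcomp Require Import ring lra.

Set Implicit Arguments.
Unset Strict Implicit.

Import Order.TTheory GRing.Theory Num.Theory.
Import numFieldNormedType.Exports.
Local Open Scope classical_set_scope.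
Local Open Scope ring_scope.

(** On the mesh, u_h lies within eps of u once h is small, so it is enough to
    squeeze the envelope between u(x) - eps and u(x) + eps for x in a compact
    K inside Omega, with a bound on h that does not depend on x.

    From below: u is convex on the closure of Omega and x is an interior point,
    so u has a supporting affine function at x ([supporting_hyperplane]).
    Lowered by eps it lies below u_h on the mesh, hence it competes in the
    supremum defining the envelope, and its value at x is u(x) - eps
    ([envelope_lower]).  Existence of the support is the finite dimensional
    Hahn-Banach theorem; it is proved by adding one coordinate direction at a
    time, the new slope being chosen between the slopes of u to the left and to
    the right of x ([slope_order], [support_slice]).

    From above: an affine function L is dominated at x by its value at some
    vertex y of the grid cell around x, namely the vertex obtained by rounding
    each coordinate up or down according to the sign of the slope of L
    ([grid_vertex_dominates]).  For h small y is a mesh point, so that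
    L(x) <= L(y) <= u_h(y) <= u(y) + eps ([envelope_upper]).  It remains to
    compare u(y) with u(x) uniformly in x, and only one inequality is needed:
    if a ball of fixed radius about x stays in Omega, extending the segment
    from x to y up to that radius and using convexity gives
    u(y) <= u(x) + O(|y - x|), where the constant depends only on the radius and
    a bound for |u| ([convex_increment]).  Compactness of K makes the radius
    independent of x ([compact_sub_open_ball]). *)

(** * Convex sets and functions *)

Lemma convex_set_comb (R : numDomainType) (E : lmodType R) (A : set E)
    (x y : E) (t : R) :
  convex_set A -> A x -> A y -> 0 <= t -> t <= 1 ->
  A (t *: x + (1 - t) *: y).
Proof.
move=> cA Ax Ay t0 t1.
have := cA x y (Itv01 t0 t1) (mem_set Ax) (mem_set Ay).
exact: set_mem.
Qed.

Lemma convex_function_comb (R : numFieldType) (E : lmodType R) (A : set E)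
    (f : E -> R) (x y : E) (t : R) :
  convex_function A f -> A x -> A y -> 0 <= t -> t <= 1 ->
  f (t *: x + (1 - t) *: y) <= t * f x + (1 - t) * f y.
Proof.
move=> cf Ax Ay t0 t1.
exact: (cf (Itv01 t0 t1) x y (mem_set Ax) (mem_set Ay)).
Qed.

Lemma closure_convex (R : realFieldType) (E : normedModType R) (A : set E) :
  convex_set A -> convex_set (closure A).
Proof.
move=> cA x y l /set_mem clx /set_mem cly; apply/mem_set => B.
move=> /nbhs_ballP[e /= e0 eB].
have [x' [Ax' xx']] := clx _ (nbhsx_ballx x _ e0).
have [y' [Ay' yy']] := cly _ (nbhsx_ballx y _ e0).
have [l0 l1] : 0 <= l%:num /\ l%:num <= 1 by split.
exists (l%:num *: x' + (1 - l%:num) *: y'); split.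
  exact: convex_set_comb.
apply: eB; move: xx' yy'; rewrite -!ball_normE /= => xx' yy'.
have -> : conv l (x : convex_lmodType E) y =
  l%:num *: x + (1 - l%:num) *: y :> E by [].
have -> : l%:num *: x + (1 - l%:num) *: y - (l%:num *: x' + (1 - l%:num) *: y')
   = l%:num *: (x - x') + (1 - l%:num) *: (y - y').
  by rewrite !scalerBr opprD addrACA.
apply: (le_lt_trans (ler_normD _ _)).
rewrite !normrZ (ger0_norm l0) ger0_norm ?subr_ge0//.
(* strictness comes from the first summand, which is lost when l = 0 *)
have [l0'|l0'] := eqVneq l%:num 0; first by rewrite l0'; lra.
have : l%:num * `|x - x'| < l%:num * e by rewrite ltr_pM2l// lt_neqAle eq_sym l0'.
have : (1 - l%:num) * `|y - y'| <= (1 - l%:num) * e.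
  by rewrite ler_wpM2l ?subr_ge0// ltW.
lra.
Qed.

(** * Supporting affine functions *)

Definition dot (R : realType) (d : nat) (a v : 'rV[R]_d) : R :=
  \sum_(i < d) a ord0 i * v ord0 i.

Lemma dotDr (R : realType) (d : nat) (a v w : 'rV[R]_d) :
  dot a (v + w) = dot a v + dot a w.
Proof.
by rewrite /dot -big_split; apply: eq_bigr => i _; rewrite mxE mulrDr.
Qed.

Lemma dotZr (R : realType) (d : nat) (a v : 'rV[R]_d) (t : R) :
  dot a (t *: v) = t * dot a v.
Proof.
by rewrite /dot mulr_sumr; apply: eq_bigr => i _; rewrite mxE mulrCA.
Qed.

Lemma dotBr (R : realType) (d : nat) (a v w : 'rV[R]_d) :
  dot a (v - w) = dot a v - dot a w.
Proof. by rewrite -scaleN1r dotDr dotZr mulN1r. Qed.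

Lemma dot_add_delta (R : realType) (d : nat) (a v : 'rV[R]_d) (c : R)
    (k : 'I_d) :
  dot (a + c *: delta_mx ord0 k) v = dot a v + c * v ord0 k.
Proof.
rewrite /dot (eq_bigr (fun i => a ord0 i * v ord0 i +
   (if i == k then c * v ord0 k else 0))).
  by rewrite big_split/= -big_mkcond big_pred1_eq.
move=> i _; rewrite !mxE eqxx /= mulrDl; congr (_ + _).
by case: eqP => [->|_]; rewrite ?mulr1 ?mulr0 ?mul0r.
Qed.

Lemma affine_dot (R : realType) (d : nat) (a : 'rV[R]_d) (b : R) :
  affine_fun (fun x => dot a x + b).
Proof. by exists a, b. Qed.

Lemma real_separation (R : realType) (A B : set R) :
  A !=set0 -> B !=set0 -> (forall p q, A p -> B q -> p <= q) ->
  exists c, (forall p, A p -> p <= c) /\ (forall q, B q -> c <= q).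
Proof.
move=> A0 [q0 Bq0] AB; exists (sup A); split => [p Ap|q Bq].
  by apply: ub_le_sup => //; exists q0 => r Ar; exact: AB.
by apply: ge_sup => // p Ap; exact: AB.
Qed.

Section Support.
Variables (R : realType) (d : nat) (D : set 'rV[R]_d) (f : 'rV[R]_d -> R).
Hypotheses (cD : convex_set D) (cf : convex_function D f).
Variable x0 : 'rV[R]_d.

(** The section of [D] by the affine subspace through [x0] spanned by the first
    [k] coordinate directions: the induction proving the Hahn-Banach argument
    runs over these. *)
Let slice (k : nat) (y : 'rV[R]_d) : Prop :=
  D y /\ forall i : 'I_d, (k <= i)%N -> y ord0 i = x0 ord0 i.

(** How far the graph of [f] is above the affine function of slope [a] through
    [(x0, f x0)]: this function supports [f] where [gap a] is nonnegative. *)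
Let gap (a y : 'rV[R]_d) : R := f y - f x0 - dot a (y - x0).

(** The segment from [z] to [y] crosses the hyperplane where the [k]-th
    coordinate is that of [x0]; the crossing point lies in the smaller slice,
    where the gap is nonnegative, and convexity bounds the gap there by the
    weighted mean of the gaps at [y] and [z]. *)
Lemma slope_order (k : 'I_d) (a y z : 'rV[R]_d) :
  (forall w, slice k w -> 0 <= gap a w) ->
  slice k.+1 y -> slice k.+1 z ->
  z ord0 k < x0 ord0 k < y ord0 k ->
  gap a z / (z ord0 k - x0 ord0 k) <= gap a y / (y ord0 k - x0 ord0 k).
Proof.
move=> supp [Dy sy] [Dz sz] /andP[zk yk].
set s := y ord0 k - x0 ord0 k; set r := x0 ord0 k - z ord0 k.
have s0 : 0 < s by rewrite subr_gt0.
have r0 : 0 < r by rewrite subr_gt0.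
have sr0 : 0 < r + s by exact: addr_gt0.
(* [t *: y + (1 - t) *: z] is the crossing point *)
pose t := r / (r + s).
have t0 : 0 <= t by rewrite divr_ge0 // ltW.
have t1 : t <= 1 by rewrite ler_pdivrMr// mul1r lerDl ltW.
have tE : t * (r + s) = r by rewrite /t divfK// gt_eqF.
have /supp gw : slice k (t *: y + (1 - t) *: z).
  split; first exact: convex_set_comb.
  move=> i; rewrite leq_eqVlt => /orP[/eqP ki|ki]; last first.
    by rewrite !mxE sy// sz// -mulrDl addrC subrK mul1r.
  have -> : i = k by exact/val_inj.
  rewrite !mxE; move: tE; rewrite /r /s; lra.
have gcomb : gap a (t *: y + (1 - t) *: z) <= t * gap a y + (1 - t) * gap a z.
  have := @convex_function_comb R _ D f y z t cf Dy Dz t0 t1.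
  by rewrite /gap !dotBr !dotDr !dotZr; lra.
have tg : 0 <= t * gap a y + (1 - t) * gap a z by exact: le_trans gcomb.
have : 0 <= (r + s) * (t * gap a y + (1 - t) * gap a z).
  by rewrite mulr_ge0// ltW.
have -> : (r + s) * (t * gap a y + (1 - t) * gap a z) =
  (t * (r + s)) * gap a y + ((r + s) - t * (r + s)) * gap a z by ring.
rewrite tE => key.
have -> : z ord0 k - x0 ord0 k = - r by rewrite opprB.
rewrite invrN mulrN -mulNr ler_pdivlMr// mulrAC ler_pdivrMr//.
lra.
Qed.

(** Interiority of [x0] provides points of [D] on both sides of [x0] in each
    coordinate direction; without them the slopes on one side could be
    unbounded and no separating slope [c] would exist. *)
Lemma support_slice : D° x0 -> forall k, (k <= d)%N ->
  exists a, forall y, slice k y -> 0 <= gap a y.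
Proof.
move=> /nbhs_ballP[e /= e0 eD]; elim=> [_|k IH kd].
  exists 0 => y [_ yx]; have -> : y = x0.
    by apply/rowP => i; apply: yx.
  by rewrite /gap !subrr /dot big1// => i _; rewrite mxE mul0r.
have [a ha] := IH (ltnW kd); pose k' := Ordinal kd.
have step (s : R) : `|s| < e -> slice k.+1 (x0 + s *: delta_mx ord0 k').
  move=> se; split.
    apply: eD; rewrite -ball_normE/= opprD addrA subrr sub0r normrN normrZ.
    apply: le_lt_trans se; rewrite ler_piMr//.
    rewrite /Num.Def.normr/= mx_normrE; apply/bigmax_leP; split => //= i _.
    by rewrite !mxE; case: (_ && _); rewrite ?normr1 ?normr0.
  move=> i ki; rewrite !mxE/= (_ : (i == k') = false) ?mulr0 ?addr0//.
  by apply/eqP => ik; move: ki; rewrite ik ltnn.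
have stepE (s : R) : (x0 + s *: delta_mx ord0 k') ord0 k' = x0 ord0 k' + s.
  by rewrite !mxE !eqxx mulr1.
have e2 : 0 < e / 2 by exact: divr_gt0.
have [c [cl cr]] : exists c,
   (forall p, [set gap a z / (z ord0 k' - x0 ord0 k') | z in
     [set z | slice k.+1 z /\ z ord0 k' < x0 ord0 k']] p -> p <= c) /\
   (forall q, [set gap a z / (z ord0 k' - x0 ord0 k') | z in
     [set z | slice k.+1 z /\ x0 ord0 k' < z ord0 k']] q -> c <= q).
  apply: real_separation.
  - apply/image_nonempty; exists (x0 + - (e / 2) *: delta_mx ord0 k').
    split; last by rewrite stepE; lra.
    by apply: step; rewrite normrN gtr0_norm//; lra.
  - apply/image_nonempty; exists (x0 + (e / 2) *: delta_mx ord0 k').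
    split; last by rewrite stepE; lra.
    by apply: step; rewrite gtr0_norm//; lra.
  - move=> _ _ [z [Dz zk] <-] [y [Dy yk] <-].
    by apply: (@slope_order k') => //; rewrite zk.
exists (a + c *: delta_mx ord0 k') => y sy.
have -> : gap (a + c *: delta_mx ord0 k') y
    = gap a y - c * (y ord0 k' - x0 ord0 k').
  by rewrite /gap dot_add_delta !mxE; lra.
rewrite subr_ge0.
have [yk|yk|yk] := ltgtP (y ord0 k') (x0 ord0 k').
- by rewrite -ler_ndivrMr ?subr_lt0//; apply: cl; exists y.
- by rewrite -ler_pdivlMr ?subr_gt0//; apply: cr; exists y.
- rewrite yk subrr mulr0; apply: ha; split; first exact: sy.1.
  move=> i; rewrite leq_eqVlt => /orP[/eqP ki|]; last exact: sy.2.
  by have -> : i = k' by exact/val_inj.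
Qed.

Lemma supporting_hyperplane : D° x0 ->
  exists a, forall y, D y -> f x0 + dot a (y - x0) <= f y.
Proof.
move=> /support_slice/(_ d (leqnn d))[a ha]; exists a => y Dy.
have : 0 <= gap a y.
  by apply: ha; split => // i; rewrite leqNgt ltn_ord.
by rewrite /gap; lra.
Qed.

End Support.

(** * The mesh *)

Lemma mesh_sub_closure (R : realType) (d : nat) (Omega : set 'rV[R]_d)
    (V : set 'rV[int]_d) (h : R) :
  mesh Omega V h `<=` closure Omega.
Proof. by move=> x [[/subset_closure //]|[[]]]. Qed.

(** Maximizing a linear form over a cube: each coordinate is rounded up where
    its coefficient is positive and down elsewhere.  The norm on row vectors is
    the sup norm, hence the distance bound [h]. *)
Lemma grid_vertex_dominates (R : realType) (d : nat) (h : R)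
    (a x : 'rV[R]_d) :
  0 < h -> exists y, [/\ grid h y, `|y - x| <= h & dot a x <= dot a y].
Proof.
move=> h0.
pose m : 'rV[int]_d :=
  \row_i (Num.floor (x ord0 i / h) + (0 < a ord0 i)%R%:Z).
pose y : 'rV[R]_d := h *: vecZ R m.
have yE i : y ord0 i = h * ((Num.floor (x ord0 i / h))%:~R + (0 < a ord0 i)%R%:R).
  by rewrite !mxE intrD.
have bnd i : h * (Num.floor (x ord0 i / h))%:~R <= x ord0 i <=
             h * (Num.floor (x ord0 i / h))%:~R + h.
  have /andP[fl fu] := floor_itv (x ord0 i / h).
  rewrite mulrC -ler_pdivlMr// fl/=.
  have := ltW fu; rewrite ler_pdivrMr// intrD; lra.
(* [y] is made opaque so that [mxE] does not unfold it below *)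
have gy : grid h y by exists m.
clearbody y; exists y; split => //.
- rewrite /Num.Def.normr/= mx_normrE; apply/bigmax_leP; split => [|[i0 i] _ /=].
    exact: ltW.
  rewrite ord1 2!mxE yE ler_norml.
  have /andP[] := bnd i.
  by case: (0 < a ord0 i); rewrite /= ?mulr1n ?mulr0n; lra.
- apply: ler_sum => i _; rewrite yE.
  have /andP[lo up] := bnd i.
  have [ai|ai] := ltP 0 (a ord0 i); rewrite /= ?mulr1n ?mulr0n ?addr0.
    by rewrite ler_wpM2l ?(ltW ai)//; lra.
  by rewrite ler_wnM2l.
Qed.

(** * Uniform estimates on compact subsets *)

(** A positive distance from [K] to the complement of [O], obtained by the
    near-covering form of compactness applied to the radii tending to 0. *)
Lemma compact_sub_open_ball (R : realType) (E : pseudoMetricType R)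
    (K O : set E) :
  compact K -> open O -> K `<=` O ->
  exists2 e : R, 0 < e & forall x, K x -> ball x e `<=` O.
Proof.
move=> cK oO KO.
have : \forall e \near (0 : R)^'+, K `<=` (fun x => ball x e `<=` O).
  move/compact_near_coveringP: cK.
  move=> /(_ R (0 : R)^'+ (fun e x => ball x e `<=` O)); apply => x Kx.
  have /nbhs_ballP[r /= r0 rO] : nbhs x O by exact/open_nbhs_nbhs/(conj oO)/KO.
  have r2 : 0 < r / 2 by exact: divr_gt0.
  exists (ball x (r / 2), [set e : R | e < r / 2]) => /=.
    by split; [exact: nbhsx_ballx | exact: nbhs_right_lt].
  move=> [y e] /= [xy er] z yz; apply: rO.
  by apply: (@ball_splitr _ _ y) => //=; [exact: ball_sym|exact/le_ball/yz/ltW].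
move=> small; have [e [/= eO e0]] := filter_ex (filterI small (nbhs_right_gt 0)).
by exists e.
Qed.

(** One-sided Lipschitz bound.  The segment from [x] to [y], prolonged by the
    factor [1 / t], ends at a point [z] within [delta] of [x]; convexity bounds
    [f y - f x] by [t] times [f z - f x].  Since [f] is bounded by [M], this is at
    most [2 * M * t]. *)
Lemma convex_increment (R : realType) (E : normedModType R) (D : set E)
    (f : E -> R) (M delta t : R) (x y : E) :
  convex_function D f -> (forall z, D z -> `|f z| <= M) ->
  (forall z, `|z - x| <= delta -> D z) -> 0 < delta ->
  0 < t -> t <= 1 -> `|y - x| <= t * delta ->
  f y <= f x + 2 * M * t.
Proof.
move=> cf fM xD delta0 t0 t1 yx.
pose z := x + t^-1 *: (y - x).
have Dx : D x by apply: xD; rewrite subrr normr0 ltW.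
have Dz : D z.
  apply: xD; rewrite /z addrC addKr normrZ gtr0_norm ?invr_gt0//.
  by rewrite ler_pdivrMl.
have -> : y = t *: z + (1 - t) *: x.
  rewrite /z scalerDr scalerA divff ?gt_eqF// scale1r scalerBl scale1r.
  by rewrite addrA -[_ + _ + x]addrA subrK addrC addKr.
apply: (le_trans (convex_function_comb cf Dz Dx (ltW t0) t1)).
have : t * f z <= t * M.
  by rewrite ler_wpM2l ?(ltW t0)// (le_trans (ler_norm _))// fM.
have : - (t * f x) <= t * M.
  by rewrite -mulrN ler_wpM2l ?(ltW t0)// (le_trans (ler_norm _))// normrN fM.
lra.
Qed.

(** * Bounds for the convex envelope *)

Lemma envelope_lower (R : realType) (d : nat) (D N : set 'rV[R]_d)
    (u v : 'rV[R]_d -> R) (x : 'rV[R]_d) (eps : R) :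
  convex_set D -> convex_function D u -> D° x -> N `<=` D ->
  (forall y, N y -> u y - eps <= v y) ->
  ((u x - eps)%:E <= convex_envelope N v x)%E.
Proof.
move=> cD cu Dx ND uv.
have [a ha] := supporting_hyperplane cD cu Dx.
apply: ereal_sup_ubound; exists (fun y => dot a y + (u x - dot a x - eps)).
  split; first exact: affine_dot.
  move=> y Ny; apply: le_trans (uv _ Ny).
  by have := ha y (ND _ Ny); rewrite dotBr; lra.
by congr (_%:E); lra.
Qed.

Lemma envelope_upper (R : realType) (d : nat) (N : set 'rV[R]_d)
    (v : 'rV[R]_d -> R) (x : 'rV[R]_d) (h B : R) :
  0 < h ->
  (forall y, grid h y -> `|y - x| <= h -> N y /\ v y <= B) ->
  (convex_envelope N v x <= B%:E)%E.
Proof.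
move=> h0 near; apply: ge_ereal_sup => _ [L [[a [b LE]] Lv] <-].
rewrite lee_fin.
have [y [gy yx axy]] := grid_vertex_dominates a x h0.
have [Ny vB] := near y gy yx.
apply: le_trans vB; apply: le_trans (Lv _ Ny).
by rewrite !LE; rewrite lerD2r.
Qed.

Lemma sup_on_cvg0 (R : realType) (d : nat) (K : set 'rV[R]_d)
    (g : nat -> 'rV[R]_d -> \bar R) :
  (forall eps : R, 0 < eps ->
     \forall k \near \oo, forall x, K x -> (g k x <= eps%:E)%E) ->
  sup_on K (g k) @[k --> \oo] --> (0%E : \bar R).
Proof.
move=> gK.
have bnd (eps : R) : 0 < eps ->
    \forall k \near \oo, (0 <= sup_on K (g k) <= eps%:E)%E.
  move=> e0; apply: filterS (gK _ e0) => k gk.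
  rewrite /sup_on le_max lexx/= ge_max lee_fin (ltW e0)/=.
  by apply: ge_ereal_sup => _ [x Kx <-]; exact: gk.
apply/fine_cvgP; split.
  apply: filterS (bnd 1 ltr01) => k /andP[l u].
  by rewrite ge0_fin_numE// (le_lt_trans u)// ltry.
apply/cvgrPdist_le => eps e0; apply: filterS (bnd _ e0) => k.
rewrite /= sub0r normrN; case: (sup_on K (g k)) => [r| |] //=.
  by rewrite !lee_fin => /andP[r0 re]; rewrite ger0_norm.
by rewrite normr0 ltW.
Qed.

Theorem lemma10 (R : realType) (d : nat) (hd : (0 < d)%N)
  (Omega : set 'rV[R]_d) (hOmega : bounded_convex_domain Omega)
  (V : set 'rV[int]_d) (hV : direction_set V)
  (u : 'rV[R]_d -> R)
  (hu_bounded : [bounded u x | x in closure Omega])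
  (hu_convex : convex_function (closure Omega) u)
  (u_ : R -> 'rV[R]_d -> R)
  (hcvg : mesh_cvg_uniform Omega V u_ u) :
  envelope_cvg_compact Omega V u_ u.
Proof.
move=> K cK KO h hh; have [h_gt0 h_cvg0] := hh.
have [oO _ _ convO] := hOmega.
have [M M0 uM] : exists2 M, 0 < M & forall z, closure Omega z -> `|u z| <= M.
  have [M M0 uM] := ex_strict_bound_gt0 hu_bounded.
  by exists M => // z Oz; exact/ltW/uM.
have [delta delta0 deltaO] := compact_sub_open_ball cK oO KO.
pose rho := delta / 2.
have rho0 : 0 < rho by exact: divr_gt0.
have rhoO x z : K x -> `|z - x| <= rho -> Omega z.
  move=> Kx zx; apply: (deltaO _ Kx); rewrite -ball_normE/= distrC.
  by apply: le_lt_trans zx _; rewrite /rho; lra.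
apply: sup_on_cvg0 => eps e0.
have eps2 : 0 < eps / 2 by exact: divr_gt0.
have [h1 h1_gt0 close] := hcvg h hh (eps / 2) eps2.
(* with this [t] the increment [2 * M * t] of u across a cell is at most
   [eps / 2], and cells of side [t * rho] around K stay inside Omega *)
pose t := Num.min 1 (eps / (4 * M)).
have t0 : 0 < t by rewrite lt_min ltr01 divr_gt0// mulr_gt0.
have t1 : t <= 1 by rewrite ge_min lexx.
have tM : 2 * M * t <= eps / 2.
  have : t <= eps / (4 * M) by rewrite ge_min lexx orbT.
  by rewrite ler_pdivlMr ?mulr_gt0//; lra.
have hsmall : \forall k \near \oo, h k < Num.min h1 (t * rho).
  have := cvgr_lt 0 h_cvg0; apply.
  by rewrite lt_min h1_gt0 mulr_gt0.
near=> k => x Kx.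
have /andP[kh1 kt] : (h k < h1) && (h k < t * rho).
  by rewrite -lt_min; near: k.
have {}close y : mesh Omega V (h k) y -> `|u_ (h k) y - u y| < eps / 2.
  by apply: close; rewrite h_gt0.
have low : ((u x - eps)%:E <= convex_envelope (mesh Omega V (h k)) (u_ (h k)) x)%E.
  apply: (@envelope_lower R d (closure Omega)) => //.
  - exact: closure_convex.
  - apply: filterS (@subset_closure _ Omega) _.
    exact/open_nbhs_nbhs/(conj oO)/KO.
  - exact: mesh_sub_closure.
  - by move=> y /close; rewrite ltr_norml => /andP[]; lra.
have up : (convex_envelope (mesh Omega V (h k)) (u_ (h k)) x <= (u x + eps)%:E)%E.
  apply: (@envelope_upper R d _ _ _ (h k)) => // y gy yx.
  have yrho : `|y - x| <= t * rho by apply: le_trans yx (ltW kt).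
  have Ny : mesh Omega V (h k) y.
    left; split => //; apply: rhoO Kx _.
    by apply: le_trans yrho _; rewrite ler_piMl// ltW.
  split => //.
  have uy : u y <= u x + 2 * M * t.
    apply: (@convex_increment R _ (closure Omega) u M rho) => // z zx.
    exact/subset_closure/(rhoO x).
  by have := close _ Ny; rewrite ltr_norml => /andP[]; lra.
case: (convex_envelope _ _ _) low up => [r| |] //=.
by rewrite !lee_fin => low up; rewrite ler_norml; lra.
Unshelve. all: by end_near. Qed.
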